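(* For every dynamising parameter $k>0$, competition result $p\in\mathcal{P}$, expected precision $\varepsilon>0$ and continuity parameter $c\in\mathbb{N}$, the following algorithm terminates and returns an element $x\in\mathcal{R}$ with $\lVert x-elo_k(p)\rVert_1\leq\varepsilon$. (1) Set $x:=0\in\mathcal{R}$. Set $\xi:=\frac{G}{G+1}$ with $G:=\frac{k\cdot(n-1)}{4}\cdot\max_{i,j\in n}(p_{ij}+p_{ji})$. Set $d^{perm}:=\infty$, $w:=0$. (2) Set $u_{ij}:=k\cdot\left(p_{ij}-\frac{p_{ij}+p_{ji}}{1+\exp(x_j-x_i)}\right)=-k\cdot\left(p_{ji}-\frac{p_{ij}+p_{ji}}{1+\exp(x_i-x_j)}\right)$ for $i,j\in n$, $i<j$. (3) Set $e_i:=-\sum_{j\in n,\,j<i}u_{ji}+\sum_{j\in n,\,j>i}u_{ij}$ for $i\in n$. (4) Set $d:=\lVert x-e\rVert_1$. If $d\leq\varepsilon$, then return $x$. (5) If $d>\xi\cdot d^{perm}$, then set $\xi:=\sqrt{\xi}$, $w:=c$, and go to (7). (6) If $w>0$, then set $w:=w-1$. Otherwise, set $\xi:=\xi^2$. (7) If $d<d^{perm}$, then set $x^{perm}:=x$, $e^{perm}:=e$, $d^{perm}:=d$. (8) Set $x:=\xi\cdot x^{perm}+(1-\xi)\cdot e^{perm}$. Go to (2).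
   Context: Fix $n\in\mathbb{N}$ with $n\geq 2$ and identify $n=\{0,1,\dots,n-1\}$ (so $i\in n$ means $0\le i\le n-1$). $\mathbb{N}$ includes $0$. The rating space is $\mathcal{R}:=\{x\in\mathbb{R}^n\mid\sum_{i\in n}x_i=0\}$, with norm $\lVert\cdot\rVert_1$. The space of competition results is $\mathcal{P}:=\{p\in\mathbb{R}^{n\times n}\mid p_{ij}\geq 0\text{ for all }i,j\in n,\ p_{ii}=0\text{ for all }i\in n\}$. For $k>0$, the classical Elo map is $$elo_k^{cl}:\mathcal{R}\times\mathcal{P}\rightarrow\mathcal{R},\quad (x,p)\mapsto k\cdot\left(\sum_{j\in n}\left(p_{ij}-\frac{p_{ij}+p_{ji}}{1+\exp(x_j-x_i)}\right)\right)_{i\in n}.$$ For every $k>0$ and $p\in\mathcal{P}$ there is exactly one $x\in\mathcal{R}$ with $x=elo_k^{cl}(x,p)$; it is denoted $elo_k(p)$ (the self-justifying rating with respect to $p$ and $k$). The algorithm is executed in exact real arithmetic. The initial value $d^{perm}=\infty$ is a formal value larger than every real number; while $d^{perm}=\infty$, the test $d>\xi\cdot d^{perm}$ in step (5) is regarded as false and the test $d<d^{perm}$ in step (7) as true. *)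

(* Defs.v *)
From HB Require Import structures.
From mathcomp Require Import all_boot all_order all_algebra.
From mathcomp Require Import all_classical all_reals all_analysis.
From mathcomp Require Import ring.

Set Implicit Arguments.
Unset Strict Implicit.
Unset Printing Implicit Defensive.

Import Order.TTheory GRing.Theory Num.Theory.

Local Open Scope classical_set_scope.
Local Open Scope ring_scope.

(* The library norm on row vectors is the sup norm. *)
Definition norm1 (R : realType) (n : nat) (x : 'rV[R]_n) : R :=
  \sum_(i < n) `|x ord0 i|.

Definition rating_space (R : realType) (n : nat) : set 'rV[R]_n :=
  [set x | \sum_(i < n) x ord0 i = 0].

Definition result_space (R : realType) (n : nat) : set 'M[R]_n :=
  [set p | (forall i j, 0 <= p i j) /\ (forall i, p i i = 0)].

Definition elo_cl (R : realType) (n : nat) (k : R) (x : 'rV[R]_n)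
    (p : 'M[R]_n) : 'rV[R]_n :=
  k *: \row_(i < n) \sum_(j < n)
    (p i j - (p i j + p j i) / (1 + expR (x ord0 j - x ord0 i))).

(* [xget 0 A] is an element of [A] as soon as [A] is nonempty; for [0 < k] and
   [p] in [result_space] the set below is a singleton. *)
Definition elo (R : realType) (n : nat) (k : R) (p : 'M[R]_n) : 'rV[R]_n :=
  xget 0 [set x | rating_space x /\ x = elo_cl k x p].

(* [0] is a neutral default for the maximum, since results are nonnegative. *)
Definition elo_G (R : realType) (n : nat) (k : R) (p : 'M[R]_n) : R :=
  k * (n.-1)%:R / 4 *
  \big[Num.max/0]_(i < n) \big[Num.max/0]_(j < n) (p i j + p j i).

(* Used by the algorithm only for [i < j]. *)
Definition elo_u (R : realType) (n : nat) (k : R) (p : 'M[R]_n)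
    (x : 'rV[R]_n) (i j : 'I_n) : R :=
  k * (p i j - (p i j + p j i) / (1 + expR (x ord0 j - x ord0 i))).

Lemma elo_uN (R : realType) (n : nat) (k : R) (p : 'M[R]_n) (x : 'rV[R]_n)
    (i j : 'I_n) :
  elo_u k p x i j =
  - (k * (p j i - (p i j + p j i) / (1 + expR (x ord0 i - x ord0 j)))).
Proof.
rewrite /elo_u -(opprB (x ord0 i) (x ord0 j)) expRN.
have E0 := expR_gt0 (x ord0 i - x ord0 j).
move: (expR _) E0 => E E0; field.
by rewrite !gt_eqF ?addr_gt0.
Qed.

Definition elo_e (R : realType) (n : nat) (k : R) (p : 'M[R]_n)
    (x : 'rV[R]_n) : 'rV[R]_n :=
  \row_(i < n) (- (\sum_(j < n | (j < i)%N) elo_u k p x j i)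
                + \sum_(j < n | (i < j)%N) elo_u k p x i j).

Record perm_data (R : realType) (n : nat) := PermData {
  x_perm : 'rV[R]_n;
  e_perm : 'rV[R]_n;
  d_perm : R
}.

(* The program variables at the start of a pass through the loop;
   [st_perm = None] encodes d^perm = oo, when x^perm and e^perm are unset. *)
Record elo_state (R : realType) (n : nat) := EloState {
  st_x : 'rV[R]_n;
  st_xi : R;
  st_w : nat;
  st_perm : option (perm_data R n)
}.

Definition elo_init (R : realType) (n : nat) (k : R) (p : 'M[R]_n) :
    elo_state R n :=
  EloState 0 (elo_G k p / (elo_G k p + 1)) 0 None.

(* One pass through the loop: [inl x] when the algorithm returns [x],
   [inr s] when it jumps back to the start of the loop in state [s].
   While d^perm = oo, the test d > xi * d^perm counts as false and the test
   d < d^perm as true; this is not the convention 0 * oo = 0 of [\bar R]. *)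
Definition elo_step (R : realType) (n : nat) (k : R) (p : 'M[R]_n) (eps : R)
    (c : nat) (s : elo_state R n) : 'rV[R]_n + elo_state R n :=
  let x := st_x s in
  let e := elo_e k p x in
  let d := norm1 (x - e) in
  if d <= eps then inl x else
  let too_large :=
    if st_perm s is Some m then st_xi s * d_perm m < d else false in
  let xi := if too_large then Num.sqrt (st_xi s)
            else if (0 < st_w s)%N then st_xi s else st_xi s ^+ 2 in
  let w := if too_large then c
           else if (0 < st_w s)%N then (st_w s - 1)%N else st_w s in
  let m := if st_perm s is Some m
           then if d < d_perm m then PermData x e d else m
           else PermData x e d in
  inr (EloState (xi *: x_perm m + (1 - xi) *: e_perm m) xi w (Some m)).

(* [elo_run k p eps c N s] makes at most [N.+1] passes starting from [s]. *)
Fixpoint elo_run (R : realType) (n : nat) (k : R) (p : 'M[R]_n) (eps : R)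
    (c N : nat) (s : elo_state R n) : option 'rV[R]_n :=
  match elo_step k p eps c s with
  | inl x => Some x
  | inr s' => if N is N'.+1 then elo_run k p eps c N' s' else None
  end.

Definition elo_algorithm_returns (R : realType) (n : nat) (k : R)
    (p : 'M[R]_n) (eps : R) (c : nat) (x : 'rV[R]_n) : Prop :=
  exists N : nat, elo_run k p eps c N (elo_init k p) = Some x.

(* Main.v *)
Require Import Defs.
From HB Require Import structures.
From mathcomp Require Import all_boot all_order all_algebra.
From mathcomp Require Import all_classical all_reals all_analysis.
From mathcomp Require Import ring lra.

(** Put [xi0 := G / (G + 1)] and [T x := xi0 x + (1 - xi0) f x], where [f] is
    the classical Elo map. The secant slopes of the logistic function lie in
    [0, 1/4], so [T x - T y] is the image of [x - y] under a nonnegative matrix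
    with column sums [xi0], and [T] is an [xi0]-contraction for the 1-norm.
    Hence [f] has a fixed point [x*], and [|x - x*| <= |x - f x|], which makes
    the stopping test sound; moreover [|T x - f (T x)| <= xi0 |x - f x|].
    In the algorithm [xi] is always [xi0 ^ (2 ^ z)] with [z >= 0], since the
    contraction rules out taking a root at [xi = xi0]. A pass either takes a
    root, lowering [z], or shrinks d^perm by the factor [xi0] at least, so
    d^perm eventually drops below the precision. *)

Set Implicit Arguments.
Unset Strict Implicit.
Unset Printing Implicit Defensive.

Import Order.TTheory GRing.Theory Num.Theory.
Import numFieldNormedType.Exports.

Local Open Scope ring_scope.

(** * The 1-norm, its comparison with the sup norm, and geometric decay *)

Section Norm1.
Variables (R : realType) (n : nat).
Implicit Types x y : 'rV[R]_n.

Lemma norm1_ge0 x : 0 <= norm1 x.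
Proof. exact: sumr_ge0. Qed.

Lemma ler_norm1D x y : norm1 (x + y) <= norm1 x + norm1 y.
Proof.
rewrite /norm1 -big_split /=; apply: ler_sum => i _.
by rewrite mxE ler_normD.
Qed.

Lemma norm1Z (a : R) x : norm1 (a *: x) = `|a| * norm1 x.
Proof.
by rewrite /norm1 mulr_sumr; apply: eq_bigr => i _; rewrite mxE normrM.
Qed.

Lemma norm1_le0_eq0 x : norm1 x <= 0 -> x = 0.
Proof.
move=> x0; apply/rowP => i; rewrite mxE; apply/eqP; rewrite -normr_le0.
apply: le_trans x0; rewrite /norm1 (bigD1 i) //=.
by rewrite lerDl sumr_ge0.
Qed.

Lemma coord_le_norm x (i : 'I_n) : `|x ord0 i| <= `|x|.
Proof.
rewrite [leRHS]/Num.Def.normr /= mx_normrE; apply/bigmax_geP; right => /=.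
by exists (ord0, i).
Qed.

Lemma norm_le_norm1 x : `|x| <= norm1 x.
Proof.
rewrite [leLHS]/Num.Def.normr /= mx_normrE; apply/bigmax_leP; split=> [|[j i] _ /=].
  exact: norm1_ge0.
by rewrite (ord1 j) /norm1 (bigD1 i) //= lerDl sumr_ge0.
Qed.

Lemma norm1_le_norm x : norm1 x <= n%:R * `|x|.
Proof.
apply: le_trans (ler_sum _ (fun i _ => coord_le_norm x i)) _.
by rewrite sumr_const card_ord mulr_natl.
Qed.

Lemma norm1_iter_contraction (T : 'rV[R]_n -> 'rV[R]_n) (q : R) (N : nat) :
  0 <= q -> (forall x y, norm1 (T x - T y) <= q * norm1 (x - y)) ->
  forall x y, norm1 (iter N T x - iter N T y) <= q ^+ N * norm1 (x - y).
Proof.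
move=> q0 Tq x y; elim: N => [|N IH] /=; first by rewrite expr0 mul1r.
by apply: le_trans (Tq _ _) _; rewrite exprS -mulrA ler_wpM2l.
Qed.

Lemma exists_exprM_le (q a e : R) : 0 <= q < 1 -> 0 < e ->
  exists N : nat, a * q ^+ N <= e.
Proof.
move=> /andP[q0 q1] e0.
have /cvgrPdist_le /(_ e e0) : (geometric a q @ \oo --> (0 : R))%classic.
  by apply: cvg_geometric; rewrite ger0_norm.
move=> [N _ /(_ N (leqnn N))] /=; rewrite sub0r normrN => h.
by exists N; apply: le_trans (ler_norm _) h.
Qed.

End Norm1.

(** * Fixed points of 1-norm contractions *)

HB.instance Definition _ (R : realType) (n : nat) :=
  NormedModule.on 'rV[R]_n.

(* A high iterate of [T] contracts the sup norm, for which the library has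
   completeness; its fixed point is then fixed by [T]. *)
Lemma norm1_fixed_point (R : realType) (n : nat) (T : 'rV[R]_n -> 'rV[R]_n)
    (q : R) : 0 <= q < 1 ->
  (forall x y, norm1 (T x - T y) <= q * norm1 (x - y)) ->
  exists x, x = T x.
Proof.
move=> q01 Tq; have /andP[q0 q1] := q01.
(* The factor [n.+1] dominates the constant [n] of the norm comparison and is at least 1 even for n
   = 0, so q^N <= 1/2 follows too. *)
have [N hN] := exists_exprM_le n.+1%:R q01 (e := 2^-1) ltac:(by rewrite invr_gt0).
have ctr : is_contraction (totalfun (iter N T) : {fun [set: _] >-> [set: _]}).
  exists 2^-1%:nng; split => /=; first by rewrite invf_lt1 // ltr1n.
  move=> [x y] _; suff : `|iter N T x - iter N T y| <= 2^-1 * `|x - y| by [].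
  apply: le_trans (norm_le_norm1 _) _.
  apply: le_trans (norm1_iter_contraction N q0 Tq x y) _.
  apply: le_trans (ler_wpM2l (exprn_ge0 N q0) (norm1_le_norm _)) _.
  rewrite mulrA ler_wpM2r //; apply: le_trans hN.
  by rewrite mulrC ler_wpM2r ?exprn_ge0 // ler_nat.
have [|x _ /= xE] := @banach_fixed_point R 'rV[R]_n _ _ ctr closedT; first by exists 0.
have {}xE : x = iter N T x := xE.
exists x; apply/eqP; rewrite -subr_eq0; apply/eqP/norm1_le0_eq0.
set a := norm1 _.
(* [T x] is fixed by the iterate as well, so contracting the pair [x], [T x] N times leaves [a]
   unchanged; q^N <= 1/2 then forces a <= 0. *)
have h : a <= q ^+ N * a.
  have := norm1_iter_contraction N q0 Tq x (T x).
  by rewrite -iterSr iterS -xE.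
have a0 : 0 <= a by exact: norm1_ge0.
have qN0 : 0 <= q ^+ N by rewrite exprn_ge0.
have qN : q ^+ N <= 2^-1.
  by apply: le_trans hN; rewrite ler_peMl // ler1n.
nra.
Qed.

(** * Secant slopes of the logistic function, and the Laplacian estimate *)

Lemma logistic_slope (R : realType) (s t : R) :
  0 <= ((1 + expR t)^-1 - (1 + expR s)^-1) / (s - t) <= 4^-1.
Proof.
wlog ts : s t / t <= s.
  move=> W; case/orP: (le_total t s) => [/W//|/W].
  by rewrite -[X in X / _]opprB -[X in _ / X]opprB invrN mulrNN.
have pos (u : R) : 0 < 1 + expR u by rewrite addr_gt0 ?expR_gt0.
pose g (u : R) := (1 + expR u)^-1.
pose dg (u : R) := - (1 + expR u) ^- 2 *: expR u.
have gd (u : R) : is_derive u 1 g (dg u).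
  apply: is_deriveV; first by rewrite gt_eqF.
  by rewrite -[X in is_derive _ _ _ X]add0r; apply: is_deriveD.
have [|c _] := @MVT_segment R g dg t s ts (fun x _ => gd x).
  apply: continuous_subspaceT => u.
  by apply/differentiable_continuous/derivable1_diffP; case: (gd u).
rewrite -/(g t) -/(g s) => gE.
have -> : g t - g s = - dg c * (s - t) by rewrite -opprB gE mulNr.
(* For s = t, division by zero makes the quotient 0. *)
have [->|nts] := eqVneq s t.
  by rewrite subrr mulr0 mul0r lexx invr_ge0 ler0n.
rewrite mulfK ?subr_eq0 // /dg scaleNr opprK.
have e0 := expR_gt0 c; move: (expR c) e0 (pos c) => E E0 E1.
rewrite /GRing.scale /= mulrC; apply/andP; split.
  by rewrite divr_ge0 ?exprn_ge0 // ltW.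
rewrite ler_pdivrMr ?exprn_gt0 //.
(* E / (1 + E)^2 <= 1/4 amounts to (1 - E)^2 >= 0. *)
have := sqr_ge0 (1 - E); nra.
Qed.

(* The matrix of [z |-> q z - (laplacian) z] has nonnegative entries and its
   columns sum to [q]. *)
Lemma laplacian_l1_contraction (R : realDomainType) (n : nat) (q : R)
    (w : 'I_n -> 'I_n -> R) (z : 'I_n -> R) :
  (forall i j, 0 <= w i j) -> (forall i j, w i j = w j i) ->
  (forall i, \sum_j w i j <= q) ->
  \sum_i `|q * z i - \sum_j w i j * (z i - z j)| <= q * \sum_i `|z i|.
Proof.
move=> w0 wC wq.
have H i : `|q * z i - \sum_j w i j * (z i - z j)| <=
    (q - \sum_j w i j) * `|z i| + \sum_j w i j * `|z j|.
  have -> : q * z i - \sum_j w i j * (z i - z j) =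
      (q - \sum_j w i j) * z i + \sum_j w i j * z j.
    under eq_bigr do rewrite mulrBr.
    by rewrite sumrB mulrBl mulr_suml; ring.
  apply: le_trans (ler_normD _ _) _; apply: lerD.
    by rewrite normrM ger0_norm // subr_ge0.
  apply: le_trans (ler_norm_sum _ _ _) _; apply: ler_sum => j _.
  by rewrite normrM ger0_norm.
apply: le_trans (ler_sum _ (fun i _ => H i)) _.
rewrite big_split /= exchange_big /= -big_split /= mulr_sumr.
apply: ler_sum => i _; rewrite -mulr_suml -mulrDl.
under [X in _ + X]eq_bigr do rewrite wC.
by rewrite subrK.
Qed.

(** * The classical Elo map and its relaxation *)

Section Elo.
Variables (R : realType) (n : nat) (k : R) (p : 'M[R]_n).
Implicit Types x y : 'rV[R]_n.

Lemma elo_u_antisym x (i j : 'I_n) : elo_u k p x i j = - elo_u k p x j i.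
Proof. by rewrite elo_uN /elo_u (addrC (p i j)). Qed.

Lemma elo_clE x (i : 'I_n) : elo_cl k x p ord0 i = \sum_j elo_u k p x i j.
Proof. by rewrite !mxE mulr_sumr. Qed.

(** Antisymmetry of [elo_u] turns the negated sum over j < i into the missing terms and kills the
    diagonal one. *)
Lemma elo_e_cl x : elo_e k p x = elo_cl k x p.
Proof.
apply/rowP => i; rewrite elo_clE mxE -sumrN.
under eq_bigr do rewrite -elo_u_antisym.
rewrite [RHS](bigID (fun j : 'I_n => (j < i)%N)) /=; congr (_ + _).
rewrite [RHS](bigD1 i) ?ltnn //=.
have -> : elo_u k p x i i = 0.
  by have := elo_u_antisym x i i; lra.
rewrite add0r; apply: eq_bigl => j.
by rewrite -leqNgt ltn_neqAle andbC eq_sym.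
Qed.

(** A double sum of antisymmetric terms equals its own opposite. *)
Lemma elo_cl_rating x : rating_space (elo_cl k x p).
Proof.
rewrite /rating_space /=; under eq_bigr do rewrite elo_clE.
set S := \sum_i _.
suff : S = - S by lra.
rewrite {1}/S exchange_big -sumrN; apply: eq_bigr => i _.
by rewrite -sumrN; apply: eq_bigr => j _; rewrite -elo_u_antisym.
Qed.

Lemma rating_space_affine (a b : R) x y :
  rating_space x -> rating_space y -> rating_space (a *: x + b *: y).
Proof.
rewrite /rating_space /= => x0 y0.
under eq_bigr do rewrite !mxE.
by rewrite big_split /= -!mulr_sumr x0 y0 !mulr0 addr0.
Qed.

Hypotheses (k0 : 0 < k) (hp : result_space p).

Let G := elo_G k p.
Let xi0 := G / (G + 1).

Lemma elo_G_ge0 : 0 <= G.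
Proof.
apply: mulr_ge0; last by apply/bigmax_geP; left.
by rewrite divr_ge0 // mulr_ge0 // ltW.
Qed.

Lemma elo_xi_bounds : 0 <= xi0 < 1.
Proof.
have G0 := elo_G_ge0.
by rewrite divr_ge0 ?addr_ge0 //= ltr_pdivrMr ?mul1r ?ltrDl // ltr_wpDl.
Qed.

(** The equation behind the choice of [xi0]: the interaction weights of an index add up to at most
    [(1 - xi0) * G], exactly the mass that the term [xi0 *: x] supplies. *)
Lemma elo_xi_compl : (1 - xi0) * G = xi0.
Proof.
have G0 := elo_G_ge0.
by rewrite /xi0; field; rewrite gt_eqF // ltr_wpDl.
Qed.

Let relax x := xi0 *: x + (1 - xi0) *: elo_cl k x p.

(** Each change of [elo_u] is a secant slope times a change of rating difference, so
    [laplacian_l1_contraction] applies to [x - y]. *)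
Lemma relax_contraction x y :
  norm1 (relax x - relax y) <= xi0 * norm1 (x - y).
Proof.
have [p0 pd] := hp; have /andP[xi_ge0 xi_lt1] := elo_xi_bounds.
pose g (t : R) := (1 + expR t)^-1.
(* Negated secant slope of the decreasing [g]; it is 0 when the two rating differences coincide. *)
pose l (i j : 'I_n) := (g (y ord0 j - y ord0 i) - g (x ord0 j - x ord0 i)) /
  ((x ord0 j - x ord0 i) - (y ord0 j - y ord0 i)).
have l_itv i j : 0 <= l i j <= 4^-1 by exact: logistic_slope.
pose M := \big[Num.max/0]_(i < n) \big[Num.max/0]_(j < n) (p i j + p j i).
have pM i j : p i j + p j i <= M.
  rewrite /M; apply/bigmax_geP; right; exists i => //.
  by apply/bigmax_geP; right; exists j.
(* This reflection makes the slopes, hence the weights, symmetric. *)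
have gN (t : R) : g (- t) = 1 - g t.
  rewrite /g expRN; have := expR_gt0 t; move: (expR t) => E E0.
  by field; rewrite !gt_eqF ?addr_gt0.
have lC i j : l i j = l j i.
  rewrite /l -(opprB (y ord0 i)) -(opprB (x ord0 i)) !gN.
  set gx := g (x _ _ - _); set gy := g (y _ _ - _).
  set dx := x _ _ - _; set dy := y _ _ - _.
  have -> : 1 - gy - (1 - gx) = - (gy - gx) by ring.
  have -> : - dx - - dy = - (dx - dy) by ring.
  by rewrite invrN mulrNN.
pose w i j := (1 - xi0) * k * (p i j + p j i) * l i j.
have w0 i j : 0 <= w i j.
  have /andP[l0 _] := l_itv i j.
  rewrite mulr_ge0 // mulr_ge0 ?addr_ge0 // mulr_ge0 ?subr_ge0 //; exact: ltW.
have wC i j : w i j = w j i by rewrite /w lC (addrC (p i j)).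
have wq i : \sum_j w i j <= xi0.
  (* The diagonal weight vanishes because [p i i] is 0; the other n - 1 terms account for the factor
     [n.-1] in [elo_G]. *)
  rewrite (bigD1 i) //= {1}/w pd addr0 mulr0 mul0r add0r.
  apply: (@le_trans _ _
    (\sum_(j < n | j != i) (1 - xi0) * (k * (M / 4)))).
    apply: ler_sum => j _; rewrite /w -!mulrA; apply: ler_wpM2l.
      by rewrite subr_ge0 ltW.
    apply: ler_wpM2l; first exact: ltW.
    have /andP[l0 l4] := l_itv i j.
    by apply: ler_pM; rewrite ?addr_ge0.
  rewrite sumr_const cardC1 card_ord -[leRHS]elo_xi_compl -mulrnAr.
  rewrite le_eqVlt; apply/orP; left; apply/eqP; congr (_ * _).
  by rewrite /G /elo_G -/M -mulr_natr; ring.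
have -> : norm1 (relax x - relax y) = \sum_i `|xi0 * (x - y) ord0 i -
    \sum_j w i j * ((x - y) ord0 i - (x - y) ord0 j)|.
  apply: eq_bigr => i _; congr `|_|.
  have rE v : relax v ord0 i =
      xi0 * v ord0 i + (1 - xi0) * \sum_j elo_u k p v i j.
    by rewrite -elo_clE mxE; congr (_ + _); rewrite mxE.
  have -> : \sum_j w i j * ((x - y) ord0 i - (x - y) ord0 j) =
      (1 - xi0) * (\sum_j elo_u k p y i j - \sum_j elo_u k p x i j).
    rewrite -sumrB mulr_sumr; apply: eq_bigr => j _; rewrite !mxE.
    rewrite /w /elo_u -/(g (x ord0 j - x ord0 i)) -/(g (y ord0 j - y ord0 i)).
    have : l i j * ((x ord0 j - x ord0 i) - (y ord0 j - y ord0 i)) =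
        g (y ord0 j - y ord0 i) - g (x ord0 j - x ord0 i).
      rewrite /l; have [->|neq] := eqVneq (x ord0 j - x ord0 i)
        (y ord0 j - y ord0 i); first by rewrite !subrr mulr0.
      by rewrite divfK // subr_eq0.
    move=> lE; rewrite -[RHS]subr0.
    transitivity (- ((1 - xi0) * k * (p i j + p j i)) *
      (l i j * ((x ord0 j - x ord0 i) - (y ord0 j - y ord0 i)))).
      by ring.
    by rewrite lE; ring.
  have -> : (relax x - relax y) ord0 i = relax x ord0 i - relax y ord0 i.
    by rewrite mxE; congr (_ + _); rewrite mxE.
  have -> : (x - y) ord0 i = x ord0 i - y ord0 i by rewrite !mxE.
  by rewrite !rE; ring.
exact: laplacian_l1_contraction.
Qed.

Lemma sub_relax x : x - relax x = (1 - xi0) *: (x - elo_cl k x p).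
Proof. by rewrite scalerBr scalerBl scale1r /relax opprD addrA. Qed.

Lemma relax_fixed x : x = relax x -> x = elo_cl k x p.
Proof.
have /andP[_ xi_lt1] := elo_xi_bounds.
move/eqP; rewrite -subr_eq0 sub_relax scaler_eq0 !subr_eq0 gt_eqF //=.
by move/eqP.
Qed.

(** The set under [xget] is inhabited: a fixed point of [relax] is one of the Elo map, whose values
    all lie in the rating space. *)
Lemma elo_fixed : elo k p = elo_cl k (elo k p) p.
Proof.
have [x /relax_fixed xE] := norm1_fixed_point elo_xi_bounds relax_contraction.
suff [] : rating_space (elo k p) /\ elo k p = elo_cl k (elo k p) p by [].
apply: (@xgetPex _ 0
  [set x | rating_space x /\ x = elo_cl k x p]%classic); exists x.
by split=> //; rewrite xE; exact: elo_cl_rating.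
Qed.

Lemma norm1_sub_relax x :
  norm1 (x - relax x) = (1 - xi0) * norm1 (x - elo_cl k x p).
Proof.
have /andP[_ xi_lt1] := elo_xi_bounds.
by rewrite sub_relax norm1Z ger0_norm // subr_ge0 ltW.
Qed.

(** Go through [relax x]: with error a and residual r, a <= (1 - xi0) r + xi0 a, and 1 - xi0 > 0
    cancels. *)
Lemma elo_error_le x : norm1 (x - elo k p) <= norm1 (x - elo_cl k x p).
Proof.
have /andP[_ xi_lt1] := elo_xi_bounds.
have fixE : relax (elo k p) = elo k p.
  by rewrite /relax -elo_fixed -scalerDl addrC subrK scale1r.
have := relax_contraction x (elo k p); rewrite fixE.
have := ler_norm1D (x - relax x) (relax x - elo k p).
rewrite addrA subrK norm1_sub_relax.
nra.
Qed.

(** Contract the pair [x], [relax x]: both displacements are residuals scaled by 1 - xi0, which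
    cancels. *)
Lemma elo_residual_relax x : norm1 (relax x - elo_cl k (relax x) p) <=
  xi0 * norm1 (x - elo_cl k x p).
Proof.
have /andP[_ xi_lt1] := elo_xi_bounds.
have := relax_contraction x (relax x); rewrite !norm1_sub_relax mulrCA.
by rewrite ler_pM2l // subr_gt0.
Qed.

(** * Loop invariant and termination of the algorithm *)

Variables (eps : R) (c : nat).

Definition elo_invariant (s : elo_state R n) (m : perm_data R n) : Prop :=
  [/\ st_perm s = Some m, rating_space (x_perm m),
      e_perm m = elo_cl k (x_perm m) p,
      d_perm m = norm1 (x_perm m - e_perm m) &
      st_x s = st_xi s *: x_perm m + (1 - st_xi s) *: e_perm m].

Definition elo_good_return (s : elo_state R n) : Prop :=
  exists N x, [/\ elo_run k p eps c N s = Some x, rating_space x &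
                  norm1 (x - elo_cl k x p) <= eps].

Lemma elo_good_return_step (s s' : elo_state R n) :
  elo_step k p eps c s = inr s' -> elo_good_return s' -> elo_good_return s.
Proof.
move=> stepE [N [x [run x0 xd]]]; exists N.+1, x; split => //.
by rewrite /= stepE.
Qed.

(** The new counter [w] is left open, since termination copes with either branch of step (6). *)
Lemma elo_pass (s : elo_state R n) (m : perm_data R n) :
  elo_invariant s m -> eps < d_perm m ->
  eps < norm1 (st_x s - elo_cl k (st_x s) p) ->
  exists s' m', [/\ elo_step k p eps c s = inr s', elo_invariant s' m',
    eps < d_perm m',
    d_perm m' <= Num.min (d_perm m) (norm1 (st_x s - elo_cl k (st_x s) p)) &
    st_xi s' =
      if st_xi s * d_perm m < norm1 (st_x s - elo_cl k (st_x s) p)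
      then Num.sqrt (st_xi s)
      else if (0 < st_w s)%N then st_xi s else st_xi s ^+ 2].
Proof.
move=> [sm xr eE dE xE] dm; set d := norm1 _ => dx.
pose m' := if d < d_perm m then PermData (st_x s) (elo_cl k (st_x s) p) d else m.
eexists; exists m'; split.
- by rewrite /elo_step elo_e_cl leNgt dx /= sm; reflexivity.
- split=> //; rewrite /m'; case: ifP => //= _.
  by rewrite xE eE; apply: rating_space_affine => //; exact: elo_cl_rating.
- by rewrite /m'; case: ifP.
- by rewrite /m' le_min; case: ltP => /= h; rewrite lexx ?andbT ?h ?ltW.
- by [].
Qed.

(** Lexicographic induction: [m] bounds the passes that can still shrink [d_perm] by [xi0], and [z]
    the square roots available before the next of them. *)
Lemma elo_terminates (m z : nat) (s : elo_state R n) (pd : perm_data R n) :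
  elo_invariant s pd -> st_xi s = xi0 ^+ (2 ^ z) -> eps < d_perm pd ->
  d_perm pd * xi0 ^+ m <= eps -> elo_good_return s.
Proof.
have /andP[xi_ge0 xi_lt1] := elo_xi_bounds.
elim: m z s pd => [|m IHm] z s pd.
  by move=> _ _ h1; rewrite expr0 mulr1 leNgt h1.
elim/ltn_ind: z s pd => z IHz s pd inv xiE epsd dm.
have [sp xr eE dE xE] := inv.
have [dle|dgt] := leP (norm1 (st_x s - elo_cl k (st_x s) p)) eps.
  exists 0, (st_x s); rewrite /= /elo_step elo_e_cl dle; split=> //.
  by rewrite xE eE; apply: rating_space_affine => //; exact: elo_cl_rating.
have [s' [pd' [stepE inv' epsd']]] := elo_pass inv epsd dgt.
rewrite le_min => /andP[dd' dle'].
case: ltP => [large|small] xi'E; apply: (elo_good_return_step stepE).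
  (* For z = 0 the current point is [relax (x_perm pd)], so its residual cannot have failed the test
     of step (5). *)
  case: z IHz xiE => [|z] IHz xiE.
    case/negP: (lt_geF large); rewrite xE xiE eE expr1 dE eE.
    exact: elo_residual_relax.
  apply: (IHz z _ s' pd') => //.
    by rewrite xi'E xiE expnSr exprM sqrtr_sqr ger0_norm // exprn_ge0.
  by apply: le_trans dm; rewrite ler_wpM2r ?exprn_ge0.
(* No root is taken: [d_perm] shrinks by [xi0] and [m] drops, so [z] may grow by the squaring of
   step (6). *)
have xi_le : st_xi s <= xi0.
  by rewrite xiE -[leRHS]expr1 ler_wiXn2l ?expn_gt0 // ltW.
have dm' : d_perm pd' * xi0 ^+ m <= eps.
  apply: le_trans dm; rewrite exprSr mulrCA mulrC ler_wpM2l ?exprn_ge0 //.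
  apply: (le_trans dle'); apply: (le_trans small).
  by rewrite mulrC ler_wpM2l // dE norm1_ge0.
case: ifP xi'E => _ xi'E.
  by apply: (IHm z s' pd'); rewrite // xi'E.
by apply: (IHm z.+1 s' pd'); rewrite // xi'E xiE -exprM -expnSr.
Qed.

Lemma elo_init_terminates : 0 < eps -> elo_good_return (elo_init k p).
Proof.
move=> eps0; have xi01 := elo_xi_bounds.
have r0 : rating_space (0 : 'rV[R]_n).
  by rewrite /rating_space /= big1 // => i _; rewrite mxE.
set d := norm1 (0 - elo_cl k 0 p).
have [dle|dgt] := leP d eps.
  by exists 0, 0; rewrite /= /elo_step elo_e_cl dle.
have [m dm] := exists_exprM_le d xi01 eps0.
pose pd := PermData 0 (elo_cl k 0 p) d.
(* With [d_perm] infinite and w = 0, the first pass squares [xi0]; hence z = 1 below. *)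
pose s := EloState (xi0 ^+ 2 *: x_perm pd + (1 - xi0 ^+ 2) *: e_perm pd)
  (xi0 ^+ 2) 0 (Some pd).
apply: (@elo_good_return_step _ s).
  by rewrite /elo_step elo_e_cl -/d leNgt dgt.
exact: (@elo_terminates m 1 s pd).
Qed.

End Elo.

Theorem mainTheorem7 (R : realType) (n : nat) (hn : (2 <= n)%N)
    (k : R) (hk : 0 < k) (p : 'M[R]_n) (hp : result_space p)
    (eps : R) (heps : 0 < eps) (c : nat) :
  exists x : 'rV[R]_n,
    [/\ elo_algorithm_returns k p eps c x,
        rating_space x
      & norm1 (x - elo k p) <= eps].
Proof.
have [N [x [run x0 xd]]] := elo_init_terminates hk hp c heps.
exists x; split=> //; first by exists N.
exact: le_trans (elo_error_le hk hp x) xd.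
Qed.
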